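(* Let $M\in\mathbb{R}^{n\times n}$ and $M'\in\mathbb{R}^{n'\times n'}$ be irreducible nonnegative matrices such that $M'\mathbf{1}_{n'}=\rho'\mathbf{1}_{n'}$ for some $\rho'\in\mathbb{R}$, and let $P=M\otimes\mathbb{J}_{n'}+\mathbb{I}_n\otimes M'$. Given $z\in\mathbb{C}$, define $\tilde z=\frac{z-\rho'}{n'}$, $g=\operatorname{gmult}_M(\tilde z)$ and $g'=\operatorname{gmult}_{M'}(z)$. Then $$\operatorname{gmult}_P(z)=\begin{cases} g & \text{if } z\notin\operatorname{spec}(M')\setminus\{\rho'\},\ \tilde z\in\operatorname{spec}(M);\\ ng' & \text{if } z\in\operatorname{spec}(M')\setminus\{\rho'\},\ \tilde z\notin\operatorname{spec}(M);\\ ng'+g & \text{if } z\in\operatorname{spec}(M')\setminus\{\rho'\},\ \tilde z\in\operatorname{spec}(M),\ ES_{M'}(z)\perp\mathbf{1}_{n'};\\ ng' & \text{if } z\in\operatorname{spec}(M')\setminus\{\rho'\},\ \tilde z\in\operatorname{spec}(M),\ ES_{M'}(z)\not\perp\mathbf{1}_{n'};\\ 0 & \text{otherwise.}\end{cases}$$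
   Context: $\mathbf{1}_n$ is the all-ones vector, $\mathbb{J}_n$ the $n\times n$ all-ones matrix, $\mathbb{I}_n$ the identity matrix, $\otimes$ the Kronecker product. $ES_A(z)$ is the (complex) eigenspace $\{\mathbf{v}: A\mathbf{v}=z\mathbf{v}\}$ and $\operatorname{gmult}_A(z)$ is its dimension ($0$ if $z$ is not an eigenvalue of $A$). $\operatorname{spec}(A)$ is the multiset of complex eigenvalues of $A$. $ES_{M'}(z)\perp\mathbf{1}_{n'}$ means $\mathbf{v}^T\mathbf{1}_{n'}=0$ for every $\mathbf{v}\in ES_{M'}(z)$, and $\not\perp$ is its negation. *)

(* Defs.v *)
From mathcomp Require Import all_boot all_order all_algebra all_fingroup.
From mathcomp Require Export boolp reals.
From mathcomp Require Export finmap multiset.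
From mathcomp Require Export complex mxtens.

Set Implicit Arguments.
Unset Strict Implicit.
Unset Printing Implicit Defensive.

Import GRing.Theory Num.Theory.
Local Open Scope ring_scope.
Local Open Scope complex_scope.

Definition nonneg_mx (R : realType) n (A : 'M[R]_n) : Prop :=
  forall i j, 0 <= A i j.

(* A is permutation-similar to a block upper triangular matrix with two
   nonempty square diagonal blocks, of sizes k and n - k. *)
Definition reducible_mx (R : realType) n (A : 'M[R]_n) : Prop :=
  exists (s : 'S_n) (k : nat), (0 < k < n)%N /\
    forall i j : 'I_n, (k <= i)%N -> (j < k)%N ->
      (perm_mx s *m A *m (perm_mx s)^T) i j = 0.

(* In particular every 1 x 1 matrix, including 0, is irreducible. *)
Definition irreducible_mx (R : realType) n (A : 'M[R]_n) : Prop :=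
  ~ reducible_mx A.

Definition complex_mx (R : realType) m n (A : 'M[R]_(m, n)) : 'M[R[i]]_(m, n) :=
  map_mx (real_complex R) A.

(* MathComp's eigenspace consists of row vectors (left eigenvectors);
   leigenspace of v |-> A *m v gives the column eigenvectors needed here. *)
Definition ES (R : realType) n (A : 'M[R[i]]_n) (z : R[i]) :
    {vspace 'cV[R[i]]_n} :=
  passmx.leigenspace (linfun (mulmx A)) z.

Lemma memES (R : realType) n (A : 'M[R[i]]_n) (z : R[i]) (v : 'cV[R[i]]_n) :
  (v \in ES A z) = (A *m v == z *: v).
Proof.
by rewrite memv_ker add_lfunE opp_lfunE scale_lfunE id_lfunE lfunE subr_eq0.
Qed.

Definition gmult (R : realType) n (A : 'M[R[i]]_n) (z : R[i]) : nat :=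
  \dim (ES A z).

(* The roots of the characteristic polynomial, with multiplicity. *)
Definition spec (R : realType) n (A : 'M[R[i]]_n) : {mset R[i]}%mset :=
  seq_mset (sval (closed_field_poly_normal (char_poly A))).

Lemma char_poly_spec (R : realType) n (A : 'M[R[i]]_n) :
  char_poly A = \prod_(z <- spec A) ('X - z%:P).
Proof.
rewrite (perm_big _ (perm_eq_seq_mset _)) /=.
case: closed_field_poly_normal => r /= {1}->.
by rewrite (monicP (char_poly_monic A)) scale1r.
Qed.

(* The product is bilinear: no complex conjugation. *)
Definition perp_ones (R : realType) n (U : {vspace 'cV[R[i]]_n}) : Prop :=
  forall v, v \in U -> v^T *m (const_mx 1 : 'cV[R[i]]_n) = 0.

(* Main.v *)
From HB Require Import structures.
Require Import Defs.
From mathcomp Require Import all_boot all_order all_algebra all_fingroup.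
From mathcomp Require Import ring.

(** Write a vector of length [n * n'] as an [n x n'] matrix [X].  Then
    [A (x) C] acts by [X |-> A X C^T], so, with [1] the all-ones column, [X]
    represents an eigenvector of [P] for [z] exactly when
    [A (X 1) 1^T + X B^T = z X], where [A] and [B] are the two given matrices
    and [B 1 = r 1].  The eigenspace [U] of such [X] is measured by rank-nullity
    for the row-sum map [X |-> X 1]; [tz] denotes [(z - r) / n'].

    Suppose [z <> r].  If [X 1 = 0], the equation says that the rows of [X] are
    eigenvectors of [B], so the kernel of the row-sum map consists of the
    matrices whose [n] rows are eigenvectors of [B] orthogonal to [1]; its
    dimension is [n] times that of the space of such vectors
    ([dim_rowsum_ker]).  In general, with [s = X 1], the equation makes
    [X - (z - r)^-1 A s 1^T] a matrix whose rows are eigenvectors of [B], and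
    taking row sums constrains [s] by [s - tz^-1 A s = (row sums of those
    eigenvectors)].  If all eigenvectors are orthogonal to [1], this says that
    [s] is an eigenvector of [A] for [tz] ([rowsum_perp]); otherwise one
    eigenvector with nonzero sum suffices to realise every [s]
    ([rowsum_nonperp]).  This gives [n g' + g] and [n (g' - 1) + n = n g'].

    Suppose [z = r].  The maximum principle for the nonnegative irreducible
    matrix [B] shows that [B w = r w + c 1] forces [c = 0] and [w] constant
    ([complex_affine_eig]).  Hence [X = s 1^T] with [A s = 0], and the
    multiplicity is that of [0 = tz] for [A] ([gmult_perron]).  The same
    property makes [r] a simple root of the characteristic polynomial
    ([char_poly_simple_root]), so that removing one copy of [r] from the
    spectrum removes [r] altogether and the condition
    [z \in spec B \ {r}] means that [z] is an eigenvalue other than [r]. *)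

Set Implicit Arguments.
Unset Strict Implicit.
Unset Printing Implicit Defensive.

Import Order.TTheory GRing.Theory Num.Theory.
Local Open Scope ring_scope.
Local Open Scope complex_scope.

(** * The maximum principle for irreducible nonnegative matrices *)

Lemma const_mx0 (V : nmodType) m n : const_mx 0 = 0 :> 'M[V]_(m, n).
Proof. by []. Qed.

(** Listing the indices outside [S] before those in [S] puts [A] in block upper
    triangular form. *)
Lemma reducible_closed_set (R : realType) n (A : 'M[R]_n) (S : {set 'I_n}) :
  S != set0 -> S != setT ->
  (forall i j, i \in S -> j \notin S -> A i j = 0) -> reducible_mx A.
Proof.
move=> S0 ST AS0.
pose l := enum (~: S) ++ enum S.
have szl : size l = n.
  by rewrite size_cat -!cardE addnC cardsC card_ord.
have ul : uniq l.
  rewrite cat_uniq !enum_uniq andbT /=; apply/hasPn => x /=.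
  by rewrite !mem_enum inE negbK.
have [i0 _] : exists i0, i0 \in S by apply/set0Pn.
pose f (i : 'I_n) := nth i0 l i.
have f_inj : injective f.
  move=> i j /eqP; rewrite nth_uniq ?szl // => /eqP; exact: val_inj.
exists (perm f_inj), #|~: S|; split.
  apply/andP; split.
    by rewrite card_gt0 -setCT (inj_eq (@setC_inj _)).
  rewrite -[ltnRHS]card_ord -(cardsC S) -[ltnLHS]add0n ltn_add2r card_gt0 //.
move=> i j ki jk.
rewrite tr_perm_mx -row_permE -col_permE !mxE.
rewrite !permE /f !nth_cat -!cardE ltnNge ki jk /=.
apply: AS0.
  rewrite -mem_enum mem_nth // -cardE ltn_subLR // addnC cardsC.
  by rewrite card_ord.
by have := mem_nth i0 (s := enum (~: S)) (n := j); rewrite -cardE mem_enum inE => ->.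
Qed.

Section MaximumPrinciple.
Variables (R : realType) (n : nat) (B : 'M[R]_n) (r : R).
Hypotheses (B_ge0 : nonneg_mx B)
  (B1 : B *m (const_mx 1 : 'cV[R]_n) = r *: const_mx 1).

Lemma row_sum_eigen i : \sum_j B i j = r.
Proof.
have /matrixP/(_ i 0) := B1; rewrite !mxE mulr1 => <-.
by apply: eq_bigr => j _; rewrite mxE mulr1.
Qed.

Lemma row_sum_differences (w : 'cV[R]_n) (c : R) i :
  B *m w = r *: w + const_mx c ->
  \sum_j B i j * (w i 0 - w j 0) = - c.
Proof.
move=> /matrixP/(_ i 0); rewrite !mxE => Bw.
under eq_bigr do rewrite mulrBr.
by rewrite sumrB -mulr_suml row_sum_eigen Bw opprD addNKr.
Qed.

(** In the row where [w] is maximal, the left-hand side of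
    [row_sum_differences] is a sum of nonnegative terms. *)
Lemma affine_eig_le0 (w : 'cV[R]_n) (c : R) : (0 < n)%N ->
  B *m w = r *: w + const_mx c -> c <= 0.
Proof.
move=> n_gt0 Bw; pose i0 := Ordinal n_gt0.
have [i _ wi] := @Order.TotalTheory.arg_maxP _ _ _ i0 xpredT (fun i => w i 0) isT.
rewrite -oppr_ge0 -(row_sum_differences i Bw).
by apply: sumr_ge0 => j _; rewrite mulr_ge0 // subr_ge0; apply: wi.
Qed.

Lemma affine_eig_eq0 (w : 'cV[R]_n) (c : R) : (0 < n)%N ->
  B *m w = r *: w + const_mx c -> c = 0.
Proof.
move=> n_gt0 Bw; apply/eqP; rewrite eq_le (affine_eig_le0 n_gt0 Bw) /=.
rewrite -oppr_le0; apply: (affine_eig_le0 (w := - w) n_gt0).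
rewrite mulmxN Bw opprD scalerN; congr (_ + _).
by apply/matrixP => i j; rewrite !mxE.
Qed.

(** In a row where [w] is maximal the nonnegative terms [B i j (w_i - w_j)] add
    up to zero, so [B] has no entry leading from the set of maximal indices to
    its complement; irreducibility then leaves no complement. *)
Lemma irreducible_eig_const (w : 'cV[R]_n) : irreducible_mx B ->
  B *m w = r *: w -> exists a, w = const_mx a.
Proof.
move=> B_irr Bw.
case: (posnP n) => [n0|n_gt0].
  by exists 0; apply/matrixP => -[i i_lt] ?; exfalso; rewrite n0 in i_lt.
pose i0 := Ordinal n_gt0.
have [i _ wi] := @Order.TotalTheory.arg_maxP _ _ _ i0 xpredT (fun i => w i 0) isT.
pose S := [set j | w j 0 == w i 0].
have ST : S = setT.
  apply/eqP/negPn/negP => ST; apply: B_irr; apply: (reducible_closed_set _ ST).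
    by apply/set0Pn; exists i; rewrite inE.
  move=> k j; rewrite !inE => /eqP wk wj.
  have Bw0 : B *m w = r *: w + const_mx 0 by rewrite Bw const_mx0 addr0.
  have /eqP := row_sum_differences k Bw0; rewrite oppr0 psumr_eq0 => [|l _]; last first.
    by rewrite mulr_ge0 // subr_ge0 wk; apply: wi.
  move=> /allP/(_ j (mem_index_enum _)) /=.
  by rewrite wk mulf_eq0 subr_eq0 [w i 0 == _]eq_sym (negPf wj) orbF => /eqP.
exists (w i 0); apply/matrixP => k j; rewrite ord1 mxE; apply/eqP.
by have := in_setT k; rewrite -ST inE.
Qed.

Let ReM (w : 'cV[R[i]]_n) :
  map_mx (@complex.Re R) (complex_mx B *m w) = B *m map_mx (@complex.Re R) w.
Proof.
apply/matrixP => i j; rewrite !mxE (big_morph _ (id1 := 0) (op1 := +%R)) //=.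
  by apply: eq_bigr => k _; rewrite !mxE; case: (w k j) => a b /=; rewrite mul0r subr0.
by move=> [a b] [c d].
Qed.

Let ImM (w : 'cV[R[i]]_n) :
  map_mx (@complex.Im R) (complex_mx B *m w) = B *m map_mx (@complex.Im R) w.
Proof.
apply/matrixP => i j; rewrite !mxE (big_morph _ (id1 := 0) (op1 := +%R)) //=.
  by apply: eq_bigr => k _; rewrite !mxE; case: (w k j) => a b /=; rewrite mul0r addr0.
by move=> [a b] [c d].
Qed.

(** For [c = 0] this is geometric simplicity of [r]; excluding [c <> 0] says
    that the all-ones vector is not in the image of [B - r], so that [r] has no
    generalized eigenvector beyond the constants.  Since [B] and [r] are real,
    the real and imaginary parts of [w] can be treated separately. *)
Lemma complex_affine_eig (w : 'cV[R[i]]_n) (c : R[i]) : (0 < n)%N ->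
  irreducible_mx B ->
  complex_mx B *m w = r%:C *: w + const_mx c ->
  c = 0 /\ exists a, w = const_mx a.
Proof.
move=> n_gt0 B_irr Bw.
have Bre : B *m map_mx (@complex.Re R) w =
    r *: map_mx (@complex.Re R) w + const_mx (complex.Re c).
  rewrite -ReM Bw; apply/matrixP => i j; rewrite !mxE.
  by case: (w i j) c {Bw} => a b [c d] /=; rewrite mul0r subr0.
have Bim : B *m map_mx (@complex.Im R) w =
    r *: map_mx (@complex.Im R) w + const_mx (complex.Im c).
  rewrite -ImM Bw; apply/matrixP => i j; rewrite !mxE.
  by case: (w i j) c {Bw Bre} => a b [c d] /=; rewrite mul0r addr0.
have c1 := affine_eig_eq0 n_gt0 Bre; have c2 := affine_eig_eq0 n_gt0 Bim.
split; first by apply/eqP; rewrite eq_complex c1 c2 !eqxx.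
rewrite c1 const_mx0 addr0 in Bre; rewrite c2 const_mx0 addr0 in Bim.
have [a /matrixP wa] := irreducible_eig_const B_irr Bre.
have [b /matrixP wb] := irreducible_eig_const B_irr Bim.
exists (a +i* b); apply/matrixP => i j; move: (wa i j) (wb i j); rewrite !mxE.
by case: (w i j) => x y /= -> ->.
Qed.

End MaximumPrinciple.

(** * Simplicity of the Perron eigenvalue *)

Section Deflation.
Variable F : fieldType.

Lemma char_poly_tr n (A : 'M[F]_n) : char_poly A^T = char_poly A.
Proof.
rewrite /char_poly -det_tr; congr (\det _).
by rewrite /char_poly_mx linearB /= tr_scalar_mx map_trmx trmxK.
Qed.

Lemma root_char_polyP n (A : 'M[F]_n) a :
  reflect (exists2 v : 'cV[F]_n, A *m v = a *: v & v != 0)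
          (root (char_poly A) a).
Proof.
rewrite -char_poly_tr -eigenvalue_root_char; apply: (iffP eigenvalueP).
  case=> v Av v0; exists v^T; last by rewrite trmx_eq0.
  by rewrite -[A]trmxK -trmx_mul Av linearZ.
case=> v Av v0; exists v^T; last by rewrite trmx_eq0.
by rewrite -trmx_mul Av linearZ.
Qed.

Lemma char_poly_conj n (A T Q : 'M[F]_n) :
  \det Q != 0 -> A *m Q = Q *m T -> char_poly A = char_poly T.
Proof.
move=> Q0 AQ; apply: (mulfI (x := (\det Q)%:P)); first by rewrite polyC_eq0.
rewrite /char_poly -det_map_mx mulrC -!det_mulmx; congr (\det _).
by rewrite /char_poly_mx mulmxBl mulmxBr -!map_mxM AQ scalar_mxC.
Qed.

Lemma char_poly_ublock m n (a : 'M[F]_m) (b : 'M[F]_(m, n)) (D : 'M[F]_n) :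
  char_poly (block_mx a b 0 D) = char_poly a * char_poly D.
Proof.
rewrite /char_poly /char_poly_mx map_block_mx scalar_mx_block opp_block_mx.
by rewrite add_block_mx map_mx0 subr0 det_ublock.
Qed.

(** Completing the all-ones vector to a basis deflates [B] to a block triangular
    matrix with diagonal blocks [r] and [D].  An eigenvector of [D] for [r]
    lifts to some [w], vanishing at the first index, with [B w - r w] constant;
    by hypothesis [w] is constant, hence zero. *)
Lemma char_poly_simple_root n (B : 'M[F]_n) (r : F) : (0 < n)%N ->
  (forall (w : 'cV[F]_n) c, B *m w = r *: w + const_mx c ->
     c = 0 /\ exists a, w = const_mx a) ->
  B *m (const_mx 1 : 'cV[F]_n) = r *: const_mx 1 ->
  exists2 q, char_poly B = ('X - r%:P) * q & ~~ root q r.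
Proof.
case: n B => // m; rewrite -[m.+1]/(1 + m)%N => B _ Baff.
set b := ursubmx B; set o : 'cV[F]_m := const_mx 1.
have o1 : (const_mx 1 : 'cV[F]_(1 + m)) = col_mx 1%:M o.
  rewrite -col_mx_const; congr col_mx.
  by apply/matrixP => i j; rewrite !ord1 !mxE.
rewrite o1 -[in X in X -> _](submxK B) mul_block_col scale_col_mx => /eq_col_mx[].
rewrite !mulmx1 => Bu Bd.
(* The columns of Q are the all-ones vector and e_1, ..., e_m. *)
pose Q : 'M[F]_(1 + m) := block_mx 1%:M 0 o 1%:M.
pose D := drsubmx B - o *m b.
have BQ : B *m Q = Q *m block_mx r%:M b 0 D.
  rewrite -[in LHS](submxK B) !mulmx_block !mulmx1 !mul1mx !mulmx0 !mul0mx !add0r.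
  rewrite !addr0 Bu Bd /D addrC subrK.
  by rewrite scalemx1 mul_mx_scalar.
exists (char_poly D).
  rewrite (char_poly_conj _ BQ); last by rewrite det_lblock !det1 mulr1 oner_eq0.
  rewrite char_poly_ublock; congr (_ * _).
  by rewrite /char_poly det_mx11 !mxE eqxx.
apply/negP => /root_char_polyP[v Dv v0].
have : B *m (Q *m col_mx 0 v) = r *: (Q *m col_mx 0 v) + const_mx ((b *m v) 0 0).
  rewrite mulmxA BQ -mulmxA mul_block_col mulmx0 mul0mx !add0r Dv.
  rewrite scalemxAr scale_col_mx scaler0.
  have -> : const_mx ((b *m v) 0 0) = Q *m col_mx (b *m v) 0.
    rewrite mul_block_col !mulmx0 mul1mx !addr0 -col_mx_const.
    congr col_mx; apply/matrixP => i j; rewrite !mxE ?ord1 //.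
    by rewrite big_ord1 !mxE mul1r.
  by rewrite -mulmxDr add_col_mx add0r addr0.
case/Baff => _ [a]; rewrite mul_block_col mulmx0 mul0mx add0r mulmx0 mul1mx add0r.
rewrite -col_mx_const => /eq_col_mx[a0 va].
have {}a0 : a = 0 by move/matrixP/(_ 0 0): a0; rewrite !mxE.
by rewrite va a0 const_mx0 eqxx in v0.
Qed.

End Deflation.

(** * Dimensions of kernels *)

Section Kernels.
Variable F : fieldType.

(** The equation constrains the [n] rows of the unknown independently, each to
    lie in the left kernel of [G]. *)
Lemma dim_lker_mulmxr n p q (G : 'M[F]_(p, q)) :
  \dim (lker (linfun (mulmxr G : 'M_(n, p) -> 'M_(n, q)))) =
  (n * \rank (kermx G))%N.
Proof.
pose h := linfun (mulmxr (row_base (kermx G)) : 'M_(n, _) -> 'M_(n, p)).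
have -> : lker (linfun (mulmxr G : 'M_(n, p) -> 'M_(n, q))) = (h @: fullv)%VS.
  apply/vspaceP => X; rewrite memv_ker lfunE /=.
  rewrite -sub_kermx -(eq_row_base (kermx G)).
  apply/submxP/memv_imgP => [[Y ->]|[Y _ ->]]; exists Y; rewrite ?memvf ?lfunE //.
rewrite limg_dim_eq ?dimvf ?dim_matrix //.
have /eqP-> : (lker h == 0)%VS; last by rewrite capv0.
apply/lker0P => X Y; rewrite !lfunE /=; exact: row_free_inj (row_base_free _) _ _.
Qed.

(** Imposing one more linear form [c] on the left kernel of [G] lowers its
    dimension by one, unless [c] already vanishes there. *)
Lemma rank_kermx_row_col n q (G : 'M[F]_(n, q)) (c : 'cV[F]_n) :
  (\rank (kermx (row_mx G c)) + (kermx G *m c != 0)%R = \rank (kermx G))%N.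
Proof.
have -> : \rank (kermx (row_mx G c)) = \rank (kermx G :&: kermx c)%MS.
  apply: eqmx_rank; apply/rV_eqP => v.
  rewrite sub_capmx !sub_kermx mul_mx_row.
  by rewrite -row_mx0 -[RHS]xpair_eqE; apply/eqP/eqP => [/eq_row_mx[-> ->]|[-> ->]].
by rewrite addnC -trmx_eq0 -rank_rV mxrank_tr mxrank_mul_ker.
Qed.

End Kernels.

(** * The action of a Kronecker product on reshaped vectors *)

Section Unvec.
Variables (F : fieldType) (m n : nat).

Definition tens_unvec (x : 'cV[F]_(m * n)) : 'M[F]_(m, n) :=
  \matrix_(i, j) x (mxtens_index (i, j)) 0.

Definition tens_vec (X : 'M[F]_(m, n)) : 'cV[F]_(m * n) :=
  \col_k X (mxtens_unindex k).1 (mxtens_unindex k).2.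

Lemma tens_unvecK : cancel tens_unvec tens_vec.
Proof.
move=> x; apply/matrixP => k j.
by rewrite !mxE ord1 -surjective_pairing mxtens_unindexK.
Qed.

Lemma tens_vecK : cancel tens_vec tens_unvec.
Proof. by move=> X; apply/matrixP => i j; rewrite !mxE mxtens_indexK. Qed.

Fact tens_unvec_is_linear : linear tens_unvec.
Proof. by move=> a x y; apply/matrixP => i j; rewrite !mxE. Qed.

HB.instance Definition _ := GRing.isLinear.Build F 'cV[F]_(m * n) 'M[F]_(m, n)
  _ tens_unvec tens_unvec_is_linear.

Lemma tens_unvec_mul (A : 'M[F]_m) (C : 'M[F]_n) x :
  tens_unvec (tensmx A C *m x) = A *m tens_unvec x *m C^T.
Proof.
apply/matrixP => i j; rewrite !mxE.
under [RHS]eq_bigr do rewrite !mxE mulr_suml.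
rewrite exchange_big pair_big /= (reindex (@mxtens_index m n)) /=; last first.
  by exists (@mxtens_unindex m n) => k _; rewrite (mxtens_indexK, mxtens_unindexK).
by apply: eq_bigr => -[k l] _; rewrite tensmxE !mxE; ring.
Qed.

End Unvec.

(** * Geometric multiplicities, spectra and orthogonality as matrix kernels *)

Section Gmult.
Variable R : realType.
Local Notation C := R[i].

Lemma memES_trmx n (A : 'M[C]_n) z v :
  (v \in ES A z) = (v^T <= kermx (A^T - z%:M))%MS.
Proof.
rewrite memES sub_kermx mulmxBr mul_mx_scalar subr_eq0 -trmx_mul -linearZ /=.
by rewrite (inj_eq trmx_inj).
Qed.

Lemma gmultE n (A : 'M[C]_n) z : gmult A z = \rank (kermx (A^T - z%:M)).
Proof.
pose t := linfun (trmx : 'cV[C]_n -> 'rV[C]_n).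
have t0 : (lker t == 0)%VS.
  by apply/lker0P => u v; rewrite !lfunE /=; apply: trmx_inj.
rewrite /gmult -(limg_dim_eq (f := t)); last by rewrite (eqP t0) capv0.
rewrite -[RHS]mul1n -dim_lker_mulmxr; congr (\dim _).
apply/vspaceP => v; rewrite memv_ker lfunE /= -sub_kermx.
apply/memv_imgP/idP => [[u]|vA].
  by rewrite memES_trmx => ? ->; rewrite lfunE.
by exists v^T; rewrite ?memES_trmx ?lfunE /= trmxK.
Qed.

Lemma perp_onesP n (A : 'M[C]_n) z :
  perp_ones (ES A z) <-> kermx (A^T - z%:M) *m (const_mx 1 : 'cV[C]_n) = 0.
Proof.
split=> [Aperp|Aker].
  apply/row_matrixP => i; rewrite row_mul row0 -[row i _]trmxK; apply: Aperp.
  by rewrite memES_trmx trmxK row_sub.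
move=> v; rewrite memES_trmx => /submxP[u ->].
by rewrite -mulmxA Aker mulmx0.
Qed.

Lemma mem_spec n (A : 'M[C]_n) z : (z \in spec A) = (0 < gmult A z)%N.
Proof.
transitivity (root (char_poly A) z).
  by rewrite char_poly_spec root_prod_XsubC.
rewrite lt0n dimv_eq0; apply/root_char_polyP/idP => [[v Av v0]|].
  apply: contraNneq v0 => E0; rewrite -memv0 -E0 memES; exact/eqP.
move=> E0; exists (vpick (ES A z)); last by rewrite vpick0.
by apply/eqP; rewrite -memES memv_pick.
Qed.

Lemma notin_specD1 n (A : 'M[C]_n) (r : C) q :
  char_poly A = ('X - r%:P) * q -> ~~ root q r -> r \notin (spec A `\ r)%mset.
Proof.
move=> Aq; apply: contra; rewrite in_msetB1 eqxx /= => /andP[r2 r_in].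
have := char_poly_spec A; rewrite (big_rem r) //= Aq => /mulfI ->.
  rewrite root_prod_XsubC -has_pred1 has_count count_rem count_mem_mset.
  by rewrite r_in /= eqxx subn_gt0.
by rewrite polyXsubC_eq0.
Qed.

End Gmult.

(** * The eigenspaces of the tensor combination *)

Section TensorSum.
Variables (R : realType) (n n' : nat).
Local Notation C := R[i].
Variables (A : 'M[C]_n) (B : 'M[C]_n') (r z : C).
Hypothesis n'_gt0 : (0 < n')%N.
Local Notation one := (const_mx 1 : 'cV[C]_n').
Hypothesis B1 : B *m one = r *: one.

Let P := tensmx A (const_mx 1 : 'M[C]_n') + tensmx (1%:M : 'M[C]_n) B.
Let tz := (z - r) / n'%:R.
Let U : {vspace 'M[C]_(n, n')} := (linfun (@tens_unvec C n n') @: ES P z)%VS.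
Let rowsum := linfun (mulmxr one : 'M[C]_(n, n') -> 'cV[C]_n).

Let n'_neq0 : n'%:R != 0 :> C. Proof. by rewrite pnatr_eq0 -lt0n. Qed.

Let ones_mul : one^T *m one = n'%:R%:M.
Proof.
apply/matrixP => i j; rewrite !ord1 !mxE eqxx.
by under eq_bigr do rewrite !mxE mulr1; rewrite sumr_const card_ord.
Qed.

Let B1T : one^T *m B^T = r *: one^T.
Proof. by rewrite -trmx_mul B1 linearZ. Qed.

Let memU X : (X \in U) = (A *m (X *m one) *m one^T + X *m B^T == z *: X).
Proof.
have ones2 : (const_mx 1)^T = one *m one^T :> 'M[C]_n'.
  by apply/matrixP => i j; rewrite !mxE big_ord1 !mxE mulr1.
have tE x : tens_unvec (P *m x) = A *m (tens_unvec x *m one) *m one^T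
    + tens_unvec x *m B^T.
  rewrite mulmxDl linearD /= !tens_unvec_mul mul1mx ones2.
  by rewrite !mulmxA.
apply/memv_imgP/eqP => [[x]|XP].
  by rewrite memES lfunE /= => /eqP Px ->; rewrite -tE Px linearZ.
exists (tens_vec X); last by rewrite lfunE /= tens_vecK.
rewrite memES -(inj_eq (can_inj (@tens_unvecK _ _ _))) tE linearZ /= tens_vecK.
by rewrite XP.
Qed.

Lemma gmult_rowsum :
  gmult P z = (\dim (U :&: lker rowsum) + \dim (rowsum @: U))%N.
Proof.
rewrite limg_ker_dim limg_dim_eq //.
have /eqP-> : lker (linfun (@tens_unvec C n n')) == 0%VS; last by rewrite capv0.
apply/lker0P => x y; rewrite !lfunE; exact: can_inj (@tens_unvecK _ _ _) _ _.
Qed.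

Lemma dim_rowsum_ker : \dim (U :&: lker rowsum) =
  (n * \rank (kermx (row_mx (B^T - z%:M) one)))%N.
Proof.
rewrite -dim_lker_mulmxr; congr (\dim _); apply/vspaceP => X.
rewrite memv_cap !memv_ker memU !lfunE /= mul_mx_row.
rewrite mulmxBr mul_mx_scalar.
apply/andP/eqP => [[/eqP XU /eqP X0]|].
  by rewrite X0 -XU X0 mulmx0 mul0mx add0r subrr row_mx0.
rewrite -row_mx0 => /eq_row_mx[/subr0_eq XB ->].
by rewrite XB mulmx0 mul0mx add0r !eqxx.
Qed.

Section OffPerron.
Hypothesis zr : z != r.

Let zr0 : z - r != 0. Proof. by rewrite subr_eq0. Qed.
Let tz0 : tz != 0. Proof. by rewrite mulf_neq0 ?invr_eq0. Qed.

(** The rows of [X - (z - r)^-1 A s 1^T] are chosen here as multiples, with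
    coefficients [d], of a single eigenvector [e] of [B]; this already reaches
    every vector of row sums that occurs. *)
Lemma rowsum_img (s : 'cV[C]_n) (e : 'cV[C]_n') (d : 'cV[C]_n) :
  B *m e = z *: e -> d *m (e^T *m one) = s - tz^-1 *: (A *m s) ->
  s \in (rowsum @: U)%VS.
Proof.
move=> Be de.
pose X := (z - r)^-1 *: (A *m s *m one^T) + d *m e^T.
have Xone : X *m one = s.
  rewrite mulmxDl -scalemxAl -!mulmxA de ones_mul mul_mx_scalar -scalemxAr scalerA.
  by rewrite /tz invfM invrK mulrC addrC subrK.
apply/memv_imgP; exists X; last by rewrite lfunE.
rewrite memU Xone mulmxDl -scalemxAl -!mulmxA B1T -trmx_mul Be !linearZ /=.
rewrite /X scalerDr !scalerA -mulmxA addrA -[X in X + _ + _]scale1r -scalerDl.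
by apply/eqP; congr (_ *: _ + _); field.
Qed.

(** The constraint [s - tz^-1 A s = (row sums of eigenvectors of B)] has a zero
    right-hand side. *)
Lemma rowsum_perp : perp_ones (ES B z) -> (rowsum @: U)%VS = ES A tz.
Proof.
move=> perp; apply/vspaceP => s; rewrite memES; apply/idP/eqP => [|As].
  case/memv_imgP => X; rewrite memU lfunE /= => /eqP; set s' := X *m _ => XU ->.
  pose Y := X - (z - r)^-1 *: (A *m s' *m one^T).
  have YB : Y *m B^T = z *: Y.
    rewrite mulmxBl -scalemxAl -(mulmxA _ one^T) B1T -scalemxAr scalerBr -XU !scalerA.
    rewrite -2!scaleNr [RHS]addrAC -[X in _ = X + _ + _]scale1r -scalerDl addrC.
    congr (_ *: _ + _).
    by field.
  have : Y *m one = 0.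
    apply/row_matrixP => i; rewrite row_mul row0 -[row i Y]trmxK; apply: perp.
    rewrite memES_trmx trmxK sub_kermx mulmxBr mul_mx_scalar -row_mul YB linearZ.
    by rewrite subrr.
  rewrite mulmxBl -/s' -scalemxAl -(mulmxA _ one^T) ones_mul mul_mx_scalar scalerA.
  move=> /subr0_eq {2}->; rewrite scalerA.
  by rewrite -[LHS]scale1r; congr (_ *: _); rewrite /tz; field; rewrite zr0.
apply: (@rowsum_img s 0 0); first by rewrite mulmx0 scaler0.
by rewrite mul0mx As scalerA mulVf // scale1r subrr.
Qed.

(** Scaling one eigenvector of nonzero sum, row by row, gives the right-hand
    side of the constraint any prescribed value. *)
Lemma rowsum_nonperp : ~ perp_ones (ES B z) -> (rowsum @: U)%VS = fullv.
Proof.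
move=> nperp; apply/vspaceP => s; rewrite memvf.
have [e Be e1] : exists2 e : 'cV[C]_n', B *m e = z *: e & (e^T *m one) 0 0 != 0.
  apply: contrapT => noe; apply: nperp => v; rewrite memES => /eqP Bv.
  apply/matrixP => i j; rewrite !ord1 [RHS]mxE; apply/eqP/negPn/negP => v1.
  by apply: noe; exists v.
pose a := (e^T *m one) 0 0; have ea : e^T *m one = a%:M := mx11_scalar _.
apply: (@rowsum_img s e (a^-1 *: (s - tz^-1 *: (A *m s)))) => //.
by rewrite ea mul_mx_scalar scalerA mulfV // scale1r.
Qed.

(** When orthogonality fails, the kernel of the row-sum map loses [n] dimensions
    with respect to [n * gmult B z], and its image, being everything, gives them
    back. *)
Lemma gmult_off_perron : gmult P z =
  if `[< perp_ones (ES B z) >] then (n * gmult B z + gmult A tz)%N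
  else (n * gmult B z)%N.
Proof.
rewrite gmult_rowsum dim_rowsum_ker (gmultE B) -(rank_kermx_row_col (B^T - z%:M) one).
case: asboolP => perp.
  by rewrite (rowsum_perp perp) ((perp_onesP B z).1 perp) eqxx addn0.
rewrite rowsum_nonperp // dimvf dim_matrix mulr1.
by case: eqP => [/perp_onesP|_] //=; rewrite mulnDr muln1.
Qed.

End OffPerron.

(** Row [i] of the eigenvector equation reads [B x = r x - (A s)_i 1], so the
    hypothesis on [B] makes each row of [X] constant and [A s] zero. *)
Lemma gmult_perron : z = r ->
  (forall (w : 'cV[C]_n') c, B *m w = r *: w + const_mx c ->
     c = 0 /\ exists a, w = const_mx a) ->
  gmult P z = gmult A tz.
Proof.
move=> zr Baff; have tz0 : tz = 0 by rewrite /tz zr subrr mul0r.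
have constU X : X \in U -> A *m (X *m one) = 0 /\ exists s, X = s *m one^T.
  rewrite memU => /eqP XU.
  have row_affine i : B *m (row i X)^T =
      r *: (row i X)^T + const_mx (- (A *m (X *m one)) i 0).
    rewrite -[B]trmxK -trmx_mul -row_mul -zr -linearZ /= -linearZ /= -XU.
    apply/matrixP => k l; rewrite !mxE big_ord1 !mxE; ring.
  split.
    apply/matrixP => i j; rewrite ord1 [RHS]mxE.
    by have [/eqP] := Baff _ _ (row_affine i); rewrite oppr_eq0 => /eqP.
  exists (\col_i X i (Ordinal n'_gt0)); apply/matrixP => i j.
  have [_ [a /matrixP aE]] := Baff _ _ (row_affine i).
  rewrite !mxE big_ord1 !mxE mulr1.
  by have := aE j 0; have := aE (Ordinal n'_gt0) 0; rewrite !mxE => -> ->.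
have rowsum_const (s : 'cV[C]_n) : s *m one^T *m one = n'%:R *: s.
  by rewrite -mulmxA ones_mul mul_mx_scalar.
rewrite gmult_rowsum (_ : (U :&: lker rowsum)%VS = 0%VS) ?dimv0 ?add0n.
  congr (\dim _); apply/vspaceP => s; rewrite memES tz0 scale0r.
  apply/memv_imgP/eqP => [[X /constU[AX _] ->]|As]; first by rewrite lfunE.
  exists (n'%:R^-1 *: s *m one^T); last first.
    by rewrite lfunE /= rowsum_const scalerA mulfV // scale1r.
  rewrite memU rowsum_const scalerA mulfV // scale1r As mul0mx add0r.
  by rewrite -mulmxA B1T zr -scalemxAr.
apply/eqP; rewrite -subv0; apply/subvP => X; rewrite memv_cap memv_ker lfunE /=.
case/andP => /constU[_ [s ->]]; rewrite rowsum_const scaler_eq0 (negPf n'_neq0) /=.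
by move/eqP->; rewrite mul0mx mem0v.
Qed.

End TensorSum.

(** * The multiplicity formula *)

Theorem theorem3p5 (R : realType) (n n' : nat) (n_gt0 : (0 < n)%N)
    (n'_gt0 : (0 < n')%N) (M : 'M[R]_n) (M' : 'M[R]_n') (rho' : R)
    (M_ge0 : nonneg_mx M) (M_irr : irreducible_mx M)
    (M'_ge0 : nonneg_mx M') (M'_irr : irreducible_mx M')
    (M'_rho' : M' *m (const_mx 1 : 'cV[R]_n') = rho' *: const_mx 1)
    (z : R[i]) :
  let P : 'M[R]_(n * n') :=
    tensmx M (const_mx 1 : 'M[R]_n') + tensmx (1%:M : 'M[R]_n) M' in
  let MC := complex_mx M in
  let MC' := complex_mx M' in
  let tz := (z - rho'%:C) / n'%:R in
  let g := gmult MC tz in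
  let g' := gmult MC' z in
  let spec'_rho' := (spec MC' `\ (rho'%:C)%C)%mset in
  gmult (complex_mx P) z =
    if (z \notin spec'_rho') && (tz \in spec MC) then g
    else if (z \in spec'_rho') && (tz \notin spec MC) then (n * g')%N
    else if [&& z \in spec'_rho', tz \in spec MC & `[< perp_ones (ES MC' z) >]]
      then (n * g' + g)%N
    else if [&& z \in spec'_rho', tz \in spec MC & `[< ~ perp_ones (ES MC' z) >]]
      then (n * g')%N
    else 0%N.
Proof.
move=> P MC MC' tz g g' spec'_rho'.
have PE : complex_mx P =
    tensmx MC (const_mx 1 : 'M_n') + tensmx (1%:M : 'M_n) MC'.
  by rewrite /complex_mx map_mxD !map_mxT map_const_mx map_mx1 rmorph1.
have B1 : MC' *m (const_mx 1 : 'cV_n') = rho'%:C *: const_mx 1.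
  have := congr1 (map_mx (real_complex R)) M'_rho'.
  by rewrite map_mxM map_mxZ !map_const_mx rmorph1.
have Baff := fun w c =>
  @complex_affine_eig _ _ _ _ M'_ge0 M'_rho' w c n'_gt0 M'_irr.
have [q MCq qr] := char_poly_simple_root n'_gt0 Baff B1.
have rho_notin : rho'%:C \notin spec'_rho' := notin_specD1 MCq qr.
have g_eq0 : tz \notin spec MC -> g = 0%N.
  by rewrite mem_spec -eqn0Ngt => /eqP.
rewrite PE; have [zr|zr] := eqVneq z rho'%:C.
  rewrite (gmult_perron MC n'_gt0 B1 zr Baff) -/tz -/g zr (negPf rho_notin) /=.
  by case: ifPn => // /g_eq0.
have z_spec : (z \in spec'_rho') = (z \in spec MC').
  by rewrite in_msetB1 (negPf zr).
rewrite (gmult_off_perron MC n'_gt0 B1 zr) -/tz -/g -/g' z_spec.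
have [z_in|z_notin] := boolP (z \in spec MC') => /=.
  have [tz_in|/g_eq0->] := boolP (tz \in spec MC) => /=; last first.
    by rewrite addn0 if_same.
  by rewrite asbool_neg; case: ifP.
have g'0 : g' = 0%N by move: z_notin; rewrite mem_spec -eqn0Ngt => /eqP.
have -> : `[< perp_ones (ES MC' z) >].
  apply/asboolP => v; have /eqP : g' = 0%N by [].
  rewrite dimv_eq0 => /eqP ->; rewrite memv0 => /eqP->.
  by rewrite trmx0 mul0mx.
by rewrite g'0 muln0 add0n; case: ifPn => // /g_eq0.
Qed.
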